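(* Let $f,g,h$ be real-valued lower semicontinuous convex functions defined on the closed convex set $\mathcal{M}=\mathcal{M}_1\times\cdots\times\mathcal{M}_n\subseteq\mathbb{R}^m$, where $f$ is $L$-smooth and $g(\bm{x})=\sum_{i=1}^n g_i(x_i)$ is block separable ($g$ and $h$ need not be differentiable). Let $\phi=f+g-h$, and assume there is $\bm{x}_\star\in\mathcal{M}$ with $\phi^\star:=\phi(\bm{x}_\star)\le\phi(\bm{x})$ for all $\bm{x}\in\mathcal{M}$. Suppose $\bm{x}^1,\ldots,\bm{x}^K$ is a sequence generated by the randomized Block Coordinate DC Algorithm (BDCA), with any choice of subgradients $\bm{v}^k\in\partial h(\bm{x}^k)$, for solving $\min_{\bm{x}\in\mathcal{M}}\phi(\bm{x})$. Then $$\min_{k\in\{1,\ldots,K\}}\mathbb{E}\big[\mathrm{gap}^L_{\mathcal{M}}(\bm{x}^k)\big]\;\le\;\frac{n}{K}\big(\phi(\bm{x}^1)-\phi^\star\big),$$ where $$\mathrm{gap}^L_{\mathcal{M}}(\bm{y})=\max_{\bm{x}\in\mathcal{M}}\min_{\bm{v}\in\partial h(\bm{y})}\Big\{\langle\nabla f(\bm{y})-\bm{v},\bm{y}-\bm{x}\rangle+g(\bm{y})-g(\bm{x})-\tfrac{L}{2}\|\bm{x}-\bm{y}\|^2\Big\}.$$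
   Context: Blocks: the coordinates of $\mathbb{R}^m$ are partitioned into $n$ non-overlapping blocks of sizes $m_1,\dots,m_n$ with $\sum_i m_i=m$. For $\bm{x}\in\mathbb{R}^m$, $x_i\in\mathbb{R}^{m_i}$ is its $i$-th block, $\bm{x}_i\in\mathbb{R}^m$ is the vector with $i$-th block $x_i$ and zeros elsewhere, and $\bar{\bm{x}}_i=\bm{x}-\bm{x}_i$. The set $\mathcal{M}$ is the product of sets $\mathcal{M}_i\subseteq\mathbb{R}^{m_i}$, so $\bm{x}\in\mathcal{M}$ iff $x_i\in\mathcal{M}_i$ for all $i$. $L$-smooth: the gradient of $f$ is Lipschitz continuous with constant $L\ge 0$; $\|\cdot\|$ is the Euclidean norm. $\partial h(\bm{y})$ is the convex subdifferential of $h$ at $\bm{y}$, i.e. the set of subgradients $\bm{v}$ with $h(\bm{x})\ge h(\bm{y})+\langle\bm{v},\bm{x}-\bm{y}\rangle$ for all $\bm{x}\in\mathcal{M}$. BDCA: start from a point $\bm{x}^1\in\mathcal{M}$. For $k=1,\dots,K$: select a subgradient $\bm{v}^k\in\partial h(\bm{x}^k)$, with blocks $v^k_i$; choose $i_k$ from $\{1,\dots,n\}$ uniformly at random; find $$x_{i_k}^{k+1}\in\arg\min_{x_{i_k}\in\mathcal{M}_{i_k}} f(\bm{x}_{i_k}+\bar{\bm{x}}^k_{i_k})+g_{i_k}(x_{i_k})-\langle v^k_{i_k},x_{i_k}\rangle;$$ set $\bm{x}^{k+1}=\bm{x}^{k+1}_{i_k}+\bar{\bm{x}}^k_{i_k}$,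 i.e. only block $i_k$ changes. $\mathbb{E}$ is the expectation over the random block choices in all iterations. *)

(* Defs.v *)
From HB Require Import structures.
From mathcomp Require Import all_boot all_order all_algebra.
From mathcomp Require Import all_classical all_reals all_analysis.

Set Implicit Arguments.
Unset Strict Implicit.
Unset Printing Implicit Defensive.

Import Order.TTheory GRing.Theory Num.Theory.
Import numFieldNormedType.Exports.

Local Open Scope classical_set_scope.
Local Open Scope ring_scope.

Section Euclidean.
Context {R : realType}.
Implicit Types p : nat.

Definition dot p (u v : 'rV[R]_p) : R := \sum_j u ord0 j * v ord0 j.

(* The library norm `|x| on row vectors is the sup norm. *)
Definition enorm p (u : 'rV[R]_p) : R := Num.sqrt (dot u u).

(* The functions of the problem only matter on M, so the gradient is taken
   relative to M: f x = f y + <w, x - y> + o(||x - y||) as x tends to y in M.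
   If f is differentiable at y in the usual sense, the usual gradient
   qualifies; at an interior point of M it is the only such w. *)
Definition is_gradient_within p (M : set 'rV[R]_p) (f : 'rV[R]_p -> R)
    (y w : 'rV[R]_p) : Prop :=
  forall e : R, 0 < e -> \forall x \near within M (nbhs y),
    `|f x - f y - dot w (x - y)| <= e * enorm (x - y).

Definition L_smooth_on p (M : set 'rV[R]_p) (f : 'rV[R]_p -> R)
    (gradf : 'rV[R]_p -> 'rV[R]_p) (L : R) : Prop :=
  [/\ 0 <= L,
      forall y, M y -> is_gradient_within M f y (gradf y)
    & forall x y, M x -> M y ->
        enorm (gradf x - gradf y) <= L * enorm (x - y)].

(* At a point outside M, [subspace M] is discrete, so this is lower
   semicontinuity of the restriction of f to M. *)
Definition lsc_on p (M : set 'rV[R]_p) (f : 'rV[R]_p -> R) : Prop :=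
  lower_semicontinuous (fun x : subspace M => (f x)%:E).

Definition subdiff p (M : set 'rV[R]_p) (h : 'rV[R]_p -> R) (y : 'rV[R]_p) :
    set 'rV[R]_p :=
  [set v | forall x, M x -> h y + dot v (x - y) <= h x].

Definition argmin (T : Type) (A : set T) (F : T -> R) : set T :=
  [set x | A x /\ forall y, A y -> F x <= F y].

(* Extended-real valued: for y on the boundary of M the subdifferential may be
   unbounded, and then the inner minimum is -oo for some x. Maximum and minimum
   are read as supremum and infimum. *)
Definition gap p (M : set 'rV[R]_p) (f : 'rV[R]_p -> R)
    (gradf : 'rV[R]_p -> 'rV[R]_p) (g h : 'rV[R]_p -> R) (L : R)
    (y : 'rV[R]_p) : \bar R :=
  ereal_sup [set ereal_inf
    [set (dot (gradf y - v) (y - x) + g y - g x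
            - L / 2 * enorm (x - y) ^+ 2)%:E | v in subdiff M h y]
    | x in M].

End Euclidean.

Section Blocks.
Context {R : realType} {n : nat} {m : 'I_n -> nat}.
Local Notation vec := 'rV[R]_(\sum_i m i).

(* x_i is [submxrow x i]; this is the vector with i-th block u and zeros
   elsewhere. *)
Definition embed_block (i : 'I_n) (u : 'rV[R]_(m i)) : vec :=
  \mxrow_j dfwith (fun j => 0 : 'rV[R]_(m j)) i u j.

Definition drop_block (i : 'I_n) (x : vec) : vec :=
  x - embed_block (submxrow x i).

Definition block_prod (M : forall i, set 'rV[R]_(m i)) : set vec :=
  [set x | forall i, M i (submxrow x i)].

Definition block_sum (g : forall i, 'rV[R]_(m i) -> R) (x : vec) : R :=
  \sum_i g i (submxrow x i).

End Blocks.

(* An outcome of K independent uniform draws from the n blocks; the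
   probability is uniform on outcomes. *)
Notation draws n K := {ffun 'I_K -> 'I_n}.

Definition expect {R : realType} (Omega : finType) (X : Omega -> \bar R) :
    \bar R :=
  ((#|Omega|%:R^-1 : R)%:E * \sum_w X w)%E.

Section Algorithm.
Context {R : realType} {n : nat} {m : 'I_n -> nat}.
Local Notation vec := 'rV[R]_(\sum_i m i).

(* Iterations are numbered from 0: in outcome w, [x k w] is the iterate
   x^(k+1), [v k w] the subgradient v^(k+1) and [w k] the block i_(k+1).
   The iterate and the subgradient of iteration k may depend in an arbitrary
   way on the blocks drawn before, but on nothing else. *)
Record BDCA (M : forall i, set 'rV[R]_(m i)) (f h : vec -> R)
    (g : forall i, 'rV[R]_(m i) -> R) (K : nat) (x1 : vec)
    (x : nat -> draws n K -> vec) (v : 'I_K -> draws n K -> vec) : Prop := {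
  BDCA_start_in : block_prod M x1 ;
  BDCA_start : forall w, x 0%N w = x1 ;
  BDCA_past_x : forall (k : nat) (w w' : draws n K), (k <= K)%N ->
    (forall j : 'I_K, (j < k)%N -> w j = w' j) -> x k w = x k w' ;
  BDCA_past_v : forall (k : 'I_K) (w w' : draws n K),
    (forall j : 'I_K, (j < k)%N -> w j = w' j) -> v k w = v k w' ;
  BDCA_subgradient : forall (k : 'I_K) (w : draws n K),
    subdiff (block_prod M) h (x k w) (v k w) ;
  BDCA_step : forall (k : 'I_K) (w : draws n K),
    exists2 u : 'rV[R]_(m (w k)),
      argmin (M (w k))
        (fun z => f (embed_block z + drop_block (w k) (x k w))
                  + g (w k) z - dot (submxrow (v k w) (w k)) z) u
    & x k.+1 w = embed_block u + drop_block (w k) (x k w)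
}.

End Algorithm.

(* Main.v *)
Require Import Defs.
From HB Require Import structures.
From mathcomp Require Import all_boot all_order all_algebra.
From mathcomp Require Import ring lra.
From mathcomp Require Import all_classical all_reals all_analysis.

(**
  Test the block-[i] subproblem at the [i]-th block of an arbitrary [z] in [M].
  The subgradient inequality for [h] and the descent lemma for [f] bound the
  decrease of [phi] along block [i] from below by the part of the expression in
  the gap that belongs to this block. The sum over [i] is the whole expression
  at [z], so the gap at [x^k] is at most [n] times the conditional expectation
  of [phi (x^k) - phi (x^(k+1))]; in expectation these decreases telescope.
*)

Set Implicit Arguments.
Unset Strict Implicit.
Unset Printing Implicit Defensive.

Import Order.TTheory GRing.Theory Num.Theory.
Import numFieldNormedType.Exports.

Local Open Scope classical_set_scope.
Local Open Scope ring_scope.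

(** * Euclidean inner product and norm on row vectors *)

Section DotProduct.
Context {R : realType} {p : nat}.
Implicit Types (u v w : 'rV[R]_p) (a : R).

Lemma dotC u v : dot u v = dot v u.
Proof. by apply: eq_bigr => j _; rewrite mulrC. Qed.

Lemma dotDr u v w : dot u (v + w) = dot u v + dot u w.
Proof. by rewrite -big_split; apply: eq_bigr => j _; rewrite mxE mulrDr. Qed.

Lemma dotZr a u v : dot u (a *: v) = a * dot u v.
Proof. by rewrite mulr_sumr; apply: eq_bigr => j _; rewrite mxE mulrCA. Qed.

Lemma dotNr u v : dot u (- v) = - dot u v.
Proof. by rewrite -scaleN1r dotZr mulN1r. Qed.

Lemma dotBr u v w : dot u (v - w) = dot u v - dot u w.
Proof. by rewrite dotDr dotNr. Qed.

Lemma dotBl u v w : dot (u - v) w = dot u w - dot v w.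
Proof. by rewrite !(dotC _ w) dotBr. Qed.

Lemma dot0r u : dot u 0 = 0.
Proof. by rewrite -(scale0r 0) dotZr mul0r. Qed.

Lemma dot_ge0 u : 0 <= dot u u.
Proof. by apply: sumr_ge0 => j _; rewrite -expr2 sqr_ge0. Qed.

Lemma sqr_enorm u : enorm u ^+ 2 = dot u u.
Proof. by rewrite sqr_sqrtr ?dot_ge0. Qed.

Lemma enorm_ge0 u : 0 <= enorm u.
Proof. exact: sqrtr_ge0. Qed.

Lemma enormZ a u : 0 <= a -> enorm (a *: u) = a * enorm u.
Proof.
move=> a0; rewrite /enorm dotZr dotC dotZr mulrA -expr2 sqrtrM ?sqr_ge0//.
by rewrite sqrtr_sqr ger0_norm.
Qed.

Lemma enorm_eq0_dot u v : enorm u = 0 -> dot v u = 0.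
Proof.
move=> u0; have := sqr_enorm u; rewrite u0 expr0n => /esym/eqP.
rewrite psumr_eq0 => [/allP z|j _]; last by rewrite -expr2 sqr_ge0.
apply: big1 => j _; have /eqP := z j (mem_index_enum _).
by move=> /eqP; rewrite mulf_eq0 orbb => /eqP ->; rewrite mulr0.
Qed.

(** Cauchy-Schwarz: for nonzero norms, the squared length of [enorm v *: u - enorm u *: v] is
    nonnegative and factors as [2 * (a * b) * (a * b - c)], where [a], [b] are the two norms and [c]
    is [dot u v]. *)
Lemma dot_le_enorm u v : dot u v <= enorm u * enorm v.
Proof.
have [u0|/eqP u0] := eqVneq (enorm u) 0.
  by rewrite u0 mul0r dotC enorm_eq0_dot.
have [v0|/eqP v0] := eqVneq (enorm v) 0.
  by rewrite v0 mulr0 enorm_eq0_dot.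
have := dot_ge0 (enorm v *: u - enorm u *: v).
rewrite dotBr !dotBl !dotZr !(dotC (_ *: _)) !dotZr -!sqr_enorm (dotC v u).
move: (enorm u) (enorm v) (dot u v) u0 v0 (enorm_ge0 u) (enorm_ge0 v).
move=> a b c /eqP a0 /eqP b0 age bge.
have a_gt0 : 0 < a by rewrite lt_def a0.
have b_gt0 : 0 < b by rewrite lt_def b0.
set e := (X in 0 <= X) => e0.
have : 0 <= (2 * (a * b)) * (a * b - c) by move: e0; rewrite /e; lra.
by rewrite pmulr_rge0 ?subr_ge0 // !mulr_gt0.
Qed.

End DotProduct.

(** * Convexity along segments and the descent lemma *)

Section Descent.
Context {R : realType} {p : nat}.
Variables (M : set 'rV[R]_p) (f : 'rV[R]_p -> R).

Lemma conv_segment (t : {i01 R}) (x y : convex_lmodType 'rV[R]_p) :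
  conv t y x = x + t%:num *: (y - x) :> 'rV[R]_p.
Proof.
rewrite /conv/= /unstable.onem scalerBl scale1r scalerBr.
by rewrite addrC addrAC -addrA.
Qed.

Lemma convex_set_segment (t : R) x y : convex_set M -> M x -> M y ->
  0 <= t <= 1 -> M (x + t *: (y - x)).
Proof.
move=> Mc /mem_set Mx /mem_set My /andP[t0 t1].
by have /set_mem := Mc _ _ (Itv01 t0 t1) My Mx; rewrite conv_segment.
Qed.

Lemma convex_function_segment (t : R) x y : convex_function M f ->
  M x -> M y -> 0 <= t <= 1 ->
  f (x + t *: (y - x)) <= f x + t * (f y - f x).
Proof.
move=> fc /mem_set Mx /mem_set My /andP[t0 t1].
have := fc (Itv01 t0 t1) _ _ My Mx; rewrite convRE /= conv_segment.
rewrite /unstable.onem; lra.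
Qed.

(** Carries a property that holds near [x] relative to [M] over to small positive steps from [x]
    towards a point of [M]. *)
Lemma within_segment x y : convex_set M -> M x -> M y ->
  x + t *: (y - x) @[t --> (0 : R)^'+] --> within M (nbhs x).
Proof.
move=> Mc Mx My A MA.
have segM : \forall t \near (0 : R)^'+, M (x + t *: (y - x)).
  near=> t; apply: convex_set_segment => //.
  by apply/andP; split; near: t;
    [exact: nbhs_right_ge|exact: nbhs_right_le ltr01].
have cv : x + t *: (y - x) @[t --> (0 : R)^'+] --> x.
  suff : x + t *: (y - x) @[t --> (0 : R)^'+] --> x + 0 *: (y - x).
    by rewrite scale0r addr0.
  apply: cvgD; first exact: cvg_cst.
  by apply: cvgZr_tmp; apply: cvg_at_right_filter; exact: cvg_id.
by apply: filterS2 (cv _ MA) segM => t; apply.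
Unshelve. all: by end_near.
Qed.

(** At a small step [t] towards [y], convexity bounds the increment of [f] above by
    [t * (f y - f x)], and the relative gradient bounds it below by [t * dot w (y - x)] up to an
    error of order [t * e]; divide by [t]. *)
Lemma convex_gradient_le w x y : convex_set M -> convex_function M f ->
  M x -> M y -> is_gradient_within M f x w -> dot w (y - x) <= f y - f x.
Proof.
move=> Mc fc Mx My fw; apply/ler_addgt0Pr => /= e e0.
pose d := enorm (y - x).
(* With this tolerance the error at step [t] is at most [t * e]; the added 1 keeps the quotient
   meaningful when [y = x]. *)
have e'0 : 0 < e / (d + 1) by rewrite divr_gt0// ltr_wpDl// enorm_ge0.
have := within_segment Mc Mx My (fw _ e'0) => /= near_t.
have t01 : \forall t \near (0 : R)^'+, 0 < t <= 1.
  near=> t; apply/andP; split; near: t; first exact: nbhs_right_gt.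
  exact: nbhs_right_le ltr01.
have [t [/andP[t0 t1] near_tx]] := filter_ex (filterI t01 near_t).
have tW : 0 <= t <= 1 by rewrite ltW.
have := convex_function_segment fc Mx My tW; move: near_tx => /=.
have -> : x + t *: (y - x) - x = t *: (y - x) by rewrite addrAC subrr add0r.
rewrite enormZ ?(ltW t0)// dotZr -/d ler_norml => /andP[h _] h1.
have : e / (d + 1) * (t * d) <= t * e.
  rewrite mulrCA ler_wpM2l ?(ltW t0)//.
  by rewrite mulrAC ler_pdivrMr ?ltr_wpDl ?enorm_ge0//
    ler_wpM2l ?(ltW e0)// lerDl.
move=> h2; rewrite -(ler_pM2l t0); lra.
Unshelve. all: by end_near.
Qed.

(** Convexity takes the place of integrating the gradient along the segment: on each small piece,
    the gradient inequality at the far endpoint bounds the increment of [f]. *)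
Lemma L_smooth_descent gradf L x y : convex_set M -> convex_function M f ->
  L_smooth_on M f gradf L -> M x -> M y ->
  f y <= f x + dot (gradf x) (y - x) + L / 2 * enorm (y - x) ^+ 2.
Proof.
move=> Mc fc [L0 fgrad fL] Mx My.
pose z (t : R) := x + t *: (y - x).
have zM t : 0 <= t <= 1 -> M (z t) by exact: convex_set_segment.
have zB s t : z t - z s = (t - s) *: (y - x).
  by rewrite /z opprD addrACA subrr add0r scalerBl.
set d := y - x in z zM zB *; set c := dot (gradf x) d.
(* The gradient inequality at [z t] gives the slope [dot (gradf (z t)) d]; by Cauchy-Schwarz and the
   Lipschitz bound between [z t] and [x], this slope exceeds [c] by at most
   [L * t * enorm d ^+ 2]. *)
have inc s t : 0 <= s -> s <= t -> t <= 1 ->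
    f (z t) - f (z s) <= (t - s) * (c + L * t * enorm d ^+ 2).
  move=> s0 st t1.
  have Mt : M (z t) by apply: zM; rewrite t1 (le_trans s0).
  have Ms : M (z s) by apply: zM; rewrite s0 (le_trans st).
  have := convex_gradient_le Mc fc Mt Ms (fgrad _ Mt).
  rewrite zB dotZr => h.
  suff : dot (gradf (z t)) d <= c + L * t * enorm d ^+ 2.
    move=> /(ler_wpM2l (_ : 0 <= t - s)); rewrite subr_ge0 => /(_ st); lra.
  have := dot_le_enorm (gradf (z t) - gradf x) d; rewrite dotBl -/c => h1.
  have := fL _ _ Mt Mx; rewrite (_ : z t - x = t *: d); last first.
    by rewrite /z addrC addKr.
  rewrite enormZ ?(le_trans s0)// => /(ler_wpM2r (enorm_ge0 d)); lra.
(* Summing [inc] over N + 1 equal pieces of the segment, rather than using it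
   once on [0, 1], is what yields the constant L / 2 in the limit. *)
have sub N (j : nat) : (j <= N.+1)%N ->
    f (z (j%:R / N.+1%:R)) - f x <= j%:R / N.+1%:R * c
      + L * enorm d ^+ 2 * (j%:R * (j%:R + 1)) / (2 * N.+1%:R ^+ 2).
  elim: j => [|j IH] jN.
    by rewrite !mul0r /z scale0r addr0 subrr mulr0 !mul0r addr0.
  have := inc (j%:R / N.+1%:R) (j.+1%:R / N.+1%:R).
  rewrite divr_ge0// ler_pM2r ?invr_gt0// ler_nat leqnSn.
  rewrite ler_pdivrMr// mul1r ler_nat => /(_ isT isT jN).
  have {IH} := IH (ltnW jN).
  have n0 : N.+1%:R != 0 :> R by rewrite pnatr_eq0.
  rewrite -[j.+1]addn1 natrD => h1 h2.
  have := lerD h2 h1; rewrite addrA subrK => /le_trans; apply.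
  by rewrite le_eqVlt; apply/orP; left; apply/eqP; field.
have z1 : z 1 = y by rewrite /z scale1r [LHS]addrC subrK.
have lim (N : nat) : f y - f x <= c + L / 2 * enorm d ^+ 2 * (1 + N.+1%:R^-1).
  have n0 : N.+1%:R != 0 :> R by rewrite pnatr_eq0.
  have := sub N N.+1 (leqnn _); rewrite divff// z1 mul1r.
  by move/le_trans; apply; rewrite le_eqVlt; apply/orP; left; apply/eqP; field.
set b := L / 2 * enorm d ^+ 2 in lim *.
have b0 : 0 <= b by rewrite mulr_ge0 ?sqr_ge0 ?divr_ge0.
apply/ler_addgt0Pr => e e0.
(* This [N] makes the discretization error [b / N.+1%:R] smaller than [e]. *)
have := truncnS_gt (b / e); set N := Num.truncn _ => bN.
have : b / N.+1%:R < e by rewrite ltr_pdivrMr// mulrC -ltr_pdivrMr.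
have := lim N; rewrite mulrDr mulr1 lerBlDl => /le_trans h /ltW be.
by apply: h; rewrite -!addrA !lerD2l.
Qed.

End Descent.

(** * Block decomposition and replacement of a single block *)

Section Blocks.
Context {R : realType} {n : nat} {m : 'I_n -> nat}.
Local Notation vec := 'rV[R]_(\sum_i m i).
Implicit Types (x y : vec) (i j : 'I_n).

Lemma dot_blocks x y :
  dot x y = \sum_i dot (submxrow x i) (submxrow y i).
Proof.
(* As the entry of a row times a column, the inner product splits by the block rule for matrix
   products. *)
have dotE q (u w : 'rV[R]_q) : dot u w = (u *m w^T) ord0 ord0.
  by rewrite mxE; apply: eq_bigr => j _; rewrite mxE.
rewrite dotE -{1}(submxrowK x) -{1}(submxrowK y) tr_mxrow mul_mxrow_mxcol.
by rewrite summxE; apply: eq_bigr => i _; rewrite dotE.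
Qed.

Lemma submxrow_embed_block i (u : 'rV[R]_(m i)) :
  submxrow (embed_block u) i = u.
Proof. by rewrite mxrowK dfwithin. Qed.

Lemma submxrow_embed_block_neq i j (u : 'rV[R]_(m i)) : i != j ->
  submxrow (embed_block u) j = 0.
Proof. by move=> ij; rewrite mxrowK dfwithout. Qed.

Lemma dot_embed_block i (u : 'rV[R]_(m i)) x :
  dot x (embed_block u) = dot (submxrow x i) u.
Proof.
rewrite dot_blocks (bigD1 i)//= submxrow_embed_block big1 ?addr0// => j ji.
by rewrite submxrow_embed_block_neq ?dot0r// eq_sym.
Qed.

Lemma embed_blockB i (u w : 'rV[R]_(m i)) :
  embed_block (u - w) = embed_block u - embed_block w.
Proof.
apply/eqP; rewrite -subr_eq0; apply/eqP.
rewrite -[LHS]submxrowK -[RHS]submxrowK; apply: eq_mxrow => j.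
rewrite !submxrowB; have [<-|ij] := eqVneq i j.
  by rewrite !submxrow_embed_block subrr submxrow0.
by rewrite !submxrow_embed_block_neq// !subr0 submxrow0.
Qed.

Lemma update_blockB i (u : 'rV[R]_(m i)) x :
  embed_block u + drop_block i x - x = embed_block (u - submxrow x i).
Proof. by rewrite /drop_block embed_blockB addrA addrAC addrK. Qed.

Lemma submxrow_update_block i (u : 'rV[R]_(m i)) x :
  submxrow (embed_block u + drop_block i x) i = u.
Proof. by rewrite submxrowD submxrowB !submxrow_embed_block subrr addr0. Qed.

Lemma submxrow_update_block_neq i j (u : 'rV[R]_(m i)) x : i != j ->
  submxrow (embed_block u + drop_block i x) j = submxrow x j.
Proof.
move=> ij.
by rewrite submxrowD submxrowB !submxrow_embed_block_neq// subr0 add0r.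
Qed.

Lemma block_prod_update (M : forall i, set 'rV[R]_(m i)) i u x :
  M i u -> block_prod M x -> block_prod M (embed_block u + drop_block i x).
Proof.
move=> Mu Mx j; have [<-|ij] := eqVneq i j.
  by rewrite submxrow_update_block.
by rewrite submxrow_update_block_neq.
Qed.

Lemma block_sum_update (g : forall i, 'rV[R]_(m i) -> R) i u x :
  block_sum g (embed_block u + drop_block i x)
  = block_sum g x + g i u - g i (submxrow x i).
Proof.
rewrite /block_sum (bigD1 i)//= submxrow_update_block [in RHS](bigD1 i)//=.
rewrite (eq_bigr (fun j => g j (submxrow x j))) => [|j ji]; first by ring.
by rewrite submxrow_update_block_neq// eq_sym.
Qed.

End Blocks.

(** * Decrease of the objective in one block step *)

Section BlockStep.
Context {R : realType} {n : nat} {m : 'I_n -> nat}.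
Local Notation vec := 'rV[R]_(\sum_i m i).
Variables (Mi : forall i, set 'rV[R]_(m i)) (f h : vec -> R)
  (gradf : vec -> vec) (g : forall i, 'rV[R]_(m i) -> R) (L : R).
Let M := block_prod Mi.
Let phi y := f y + block_sum g y - h y.

(* The contribution of block [i] to the expression in braces in the definition
   of the gap, with [q] in the place of [gradf y - v]. *)
Definition block_gap (q y z : vec) (i : 'I_n) : R :=
  dot (submxrow q i) (submxrow (y - z) i) + g (submxrow y i)
  - g (submxrow z i) - L / 2 * enorm (submxrow (z - y) i) ^+ 2.

Lemma sum_block_gap (q y z : vec) :
  \sum_i block_gap q y z i = dot q (y - z) + block_sum g y - block_sum g z
    - L / 2 * enorm (z - y) ^+ 2.
Proof.
rewrite /block_gap !big_split /= !sumrN -mulr_sumr dot_blocks.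
rewrite sqr_enorm [dot (z - y) _]dot_blocks; congr (_ - _ * _).
by apply: eq_bigr => i _; rewrite sqr_enorm.
Qed.

(** Both displacements from [y], to the new iterate and to [y] with block [i] taken from [z], live
    in block [i], so all inner products reduce to that block. When the three inequalities are added,
    the terms in [dot (submxrow v i) u] cancel. *)
Lemma block_step_decrease (i : 'I_n) (y z v : vec) u :
  convex_set M -> convex_function M f -> L_smooth_on M f gradf L ->
  M y -> M z -> subdiff M h y v ->
  argmin (@Mi i) (fun t => f (embed_block t + drop_block i y) + g t
                          - dot (submxrow v i) t) u ->
  block_gap (gradf y - v) y z i
    <= phi y - phi (embed_block u + drop_block i y).
Proof.
move=> Mc fc fL My Mz hv [Mu u_min].
have := hv _ (block_prod_update Mu My).
rewrite update_blockB dot_embed_block dotBr => sub_h.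
(* The descent lemma is applied at the test point, with block [submxrow z i]; the value of [f] at
   the new iterate is controlled through the minimality of [u]. *)
have := L_smooth_descent Mc fc fL My (block_prod_update (Mz i) My).
rewrite update_blockB dot_embed_block sqr_enorm dot_embed_block.
rewrite submxrow_embed_block -sqr_enorm => descent.
have := u_min _ (Mz i).
rewrite /phi block_sum_update /block_gap !submxrowB dotBl.
move: descent; rewrite !dotBr; lra.
Qed.

End BlockStep.

(** * Redrawing the block of one iteration *)

Section Resample.
Context {n K : nat}.
Implicit Types (w : draws n K) (k : 'I_K) (i : 'I_n).

(** Averaging over [i] plays the role of the conditional expectation given the draws before [k], for
    quantities that depend only on the draws up to [k]. *)
Definition resample w k i : draws n K :=
  [ffun j => if j == k then i else w j].

Lemma resample_at w k i : resample w k i k = i.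
Proof. by rewrite ffunE eqxx. Qed.

Lemma resample_past w k i (j : 'I_K) : (j < k)%N -> resample w k i j = w j.
Proof. by move=> jk; rewrite ffunE -val_eqE /= ltn_eqF. Qed.

(* [(w, i) |-> (resample w k i, w k)] is an involution of the pairs. *)
Lemma sum_resample (V : nmodType) (F : draws n K -> V) k :
  \sum_w \sum_i F (resample w k i) = (\sum_w F w) *+ n.
Proof.
pose swap (q : draws n K * 'I_n) := (resample q.1 k q.2, q.1 k).
have swapK : involutive swap.
  move=> [w i]; rewrite /swap /= resample_at; congr pair.
  by apply/ffunP => j; rewrite !ffunE; case: eqP => // ->.
rewrite pair_big /= (reindex_inj (inv_inj swapK)) /=.
rewrite (eq_bigr (fun q => F q.1)) => [|q _]; last first.
  by rewrite -[in RHS](swapK q).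
rewrite -(pair_big xpredT xpredT (fun w _ => F w)) /= -sumrMnl.
by apply: eq_bigr => w _; rewrite sumr_const card_ord.
Qed.

End Resample.

(** * Means over finite types *)

Section Averages.
Context {R : realType}.

(** If every value exceeded the mean, the deviations would be positive and yet sum to zero. *)
Lemma exists_le_mean (I : finType) (a : I -> R) : (0 < #|I|)%N ->
  exists i, a i <= #|I|%:R^-1 * \sum_i a i.
Proof.
move=> I0; set c := _ * _; apply: contrapT => /forallNP nle.
have lt i : 0 < a i - c by rewrite subr_gt0 ltNge; apply/negP; exact: nle.
have : \sum_i (a i - c) == 0.
  rewrite sumrB sumr_const -[c *+ _]mulr_natl mulVKf ?subrr//.
  by rewrite pnatr_eq0 -lt0n.
rewrite psumr_eq0 => [/allP z|i _]; last exact: ltW.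
have /card_gt0P[i _] := I0.
by have := z i (mem_index_enum _); rewrite (gt_eqF (lt i)).
Qed.

(** Passes from the extended-real gap to real bounds, so that the averaging can be done in [R]. *)
Lemma expect_le (Omega : finType) (X : Omega -> \bar R) (r : Omega -> R) :
  (forall w, X w <= (r w)%:E)%E ->
  (expect X <= (#|Omega|%:R^-1 * \sum_w r w)%:E)%E.
Proof.
move=> Xr; rewrite /expect EFinM lee_wpmul2l ?lee_fin//.
by rewrite -sumEFin; apply: lee_sum => w _.
Qed.

End Averages.

Theorem mainTheorem2 (R : realType) (n : nat) (m : 'I_n -> nat)
  (Mi : forall i : 'I_n, set 'rV[R]_(m i))
  (f h : 'rV[R]_(\sum_i m i) -> R)
  (gradf : 'rV[R]_(\sum_i m i) -> 'rV[R]_(\sum_i m i))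
  (gi : forall i : 'I_n, 'rV[R]_(m i) -> R)
  (L : R) (K : nat) (xstar x1 : 'rV[R]_(\sum_i m i))
  (x : nat -> draws n K -> 'rV[R]_(\sum_i m i))
  (v : 'I_K -> draws n K -> 'rV[R]_(\sum_i m i)) :
  let M := block_prod Mi in
  let g := block_sum gi in
  let phi := fun y => f y + g y - h y in
  (0 < n)%N -> (0 < K)%N ->
  closed M -> convex_set M ->
  convex_function M f -> convex_function M g -> convex_function M h ->
  lsc_on M f -> lsc_on M g -> lsc_on M h ->
  L_smooth_on M f gradf L ->
  M xstar -> (forall y, M y -> phi xstar <= phi y) ->
  BDCA Mi f h gi x1 x v ->
  (\big[Order.min/+oo]_(k < K)
     expect (fun w => gap M f gradf g h L (x k w))
   <= (n%:R / K%:R * (phi x1 - phi xstar))%:E)%E.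
Proof.
move=> M g phi n0 K0 _ Mc fc _ _ _ _ _ fL _ phi_min.
move=> [Mx1 x0 past_x past_v sub_v step].
have Mx k w : (k <= K)%N -> M (x k w).
  elim: k => [|k IH] kK; first by rewrite x0.
  have [u [Mu _] /= ->] := step (Ordinal kK) w.
  by apply: block_prod_update => //; apply: IH; exact: ltnW.
(* Redrawing block [k] changes neither the iterate nor the subgradient of iteration [k], which
   depend only on earlier draws, and it makes the algorithm update block [i]. *)
have decrease (k : 'I_K) w z i : M z ->
    block_gap gi L (gradf (x k w) - v k w) (x k w) z i
      <= phi (x k w) - phi (x k.+1 (resample w k i)).
  move=> Mz; set w' := resample w k i.
  have w'w (j : 'I_K) : (j < k)%N -> w' j = w j by exact: resample_past.
  have xk : x k w' = x k w by apply: past_x => //; exact: ltnW.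
  have vk : v k w' = v k w by exact: past_v.
  have [u u_min ->] := step k w'.
  rewrite -xk -vk -[X in block_gap _ _ _ _ _ X](resample_at w k i).
  apply: (block_step_decrease Mc fc fL) => //; last first.
    by apply: Mx; exact: ltnW.
have gap_le (k : 'I_K) w : (gap M f gradf g h L (x k w)
    <= (\sum_i (phi (x k w) - phi (x k.+1 (resample w k i))))%:E)%E.
  (* The bound does not depend on [z], so it passes to the supremum; the selected subgradient
     [v k w] bounds the infimum. *)
  apply: ge_ereal_sup => _ [z Mz <-]; apply: ge_ereal_inf.
  exists (\sum_i block_gap gi L (gradf (x k w) - v k w) (x k w) z i)%:E.
    by exists (v k w); rewrite ?sum_block_gap//.
  by rewrite lee_fin; apply: ler_sum => i _; exact: decrease.
(* The index [k] is chosen for the expected upper bounds on the gaps: one of them is at most their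
   mean over the iterations. *)
have /(exists_le_mean (fun k : 'I_K => #|draws n K|%:R^-1 *
    \sum_w \sum_i (phi (x k w) - phi (x k.+1 (resample w k i))))) :
  (0 < #|'I_K|)%N by rewrite card_ord.
move=> [k k_le].
apply: (bigmin_inf k) => //; apply: le_trans (expect_le (gap_le k)) _.
rewrite lee_fin; apply: (le_trans k_le).
have Omega0 : #|draws n K|%:R != 0 :> R.
  by rewrite card_ffun !card_ord pnatr_eq0 expn_eq0 gtn_eqF.
rewrite card_ord -mulr_sumr [n%:R / _]mulrC -mulrA ler_wpM2l ?invr_ge0//.
rewrite mulrC ler_pdivrMr; last by rewrite lt_def Omega0 ler0n.
(* The first term is constant in [i] and is counted [n] times; [sum_resample] gives the same factor
   for the second. *)
have mean_step (j : 'I_K) :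
    \sum_w \sum_i (phi (x j w) - phi (x j.+1 (resample w j i)))
    = n%:R * \sum_w (phi (x j w) - phi (x j.+1 w)).
  rewrite sumrB mulrBr !mulr_natl.
  rewrite -(sum_resample (fun w => phi (x j.+1 w)) j) -sumrMnl -sumrB.
  by apply: eq_bigr => w _; rewrite sumrB sumr_const card_ord.
under eq_bigr do rewrite mean_step.
rewrite -mulr_sumr -mulrA ler_wpM2l// exchange_big /=.
rewrite mulr_natr -sumr_const; apply: ler_sum => w _.
rewrite -(big_mkord xpredT (fun j => phi (x j w) - phi (x j.+1 w))).
(* For each outcome the sum telescopes to [phi (x 0 w) - phi (x K w)]. Here [x K w], the point
   produced by the last iteration, lies in [M], so its value is at least [phi xstar]. *)
rewrite (@telescope_sumr_eq _ _ _ (fun j => - phi (x j w))) => [|//|j _].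
  rewrite opprK addrC x0 lerD2l lerN2.
  exact: phi_min (Mx _ _ (leqnn K)).
by rewrite opprK addrC.
Qed.
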